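(* Let $R$ be a ring and let $R\hookrightarrow R(+)R$ be the canonical injective ring homomorphism, given by $r\mapsto (r,0)$ for all $r\in R$. Then for any $a,b\in R$, $R[(a,b)]\subset R(+)R$ is a minimal ring extension if and only if the ideal $\langle b\rangle$ is a maximal ideal of $R$.
   Context: All rings are commutative with nonzero identity, and all ring extensions (subrings) and ring homomorphisms are unital. For a proper subring $A$ of a ring $B$, the extension $A\subset B$ is called a minimal ring extension (equivalently, $A$ is a maximal subring of $B$) if there is no ring $S$ with $A\subset S\subset B$, where $\subset$ denotes proper inclusion. For a ring $R$ and an $R$-module $E$, the idealization $R(+)E$ is the ring whose additive group is $R\oplus E$ with multiplication $(r_1,e_1)(r_2,e_2)=(r_1r_2,\,r_1e_2+r_2e_1)$. $R$ is viewed as a subring of $R(+)R$ via $r\mapsto (r,0)$, and $R[(a,b)]$ denotes the subring of $R(+)R$ generated by (the image of) $R$ and the element $(a,b)$. $\langle b\rangle$ denotes the principal ideal of $R$ generated by $b$. *)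

(* Defs.v *)
From HB Require Import structures.
From mathcomp Require Import all_boot all_algebra.
From mathcomp Require Import boolp classical_sets.

Set Implicit Arguments.
Unset Strict Implicit.
Unset Printing Implicit Defensive.

Import GRing.Theory.
Local Open Scope classical_set_scope.
Local Open Scope ring_scope.

(* Subsets are Prop-valued sets, so that all subrings and ideals are covered,
   not only the decidable ones; [in A] is the classical membership predicate. *)

Section MinimalExtensions.
Variables R S : comNzRingType.

Definition is_subring (A : set S) : Prop := subring_closed [in A].

(* The extension A of S is given by a subset A of the ring S. *)
Definition minimal_ring_extension (A : set S) : Prop :=
  [/\ is_subring A, A `<` setT &
      ~ exists B : set S, [/\ is_subring B, A `<` B & B `<` setT]].

Definition adjoin (f : {rmorphism R -> S}) (x : S) : set S :=
  smallest is_subring (range f `|` [set x]).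

Definition principal_ideal (b : R) : set R := range (fun r => r * b).

(* idealr_closed includes properness of the ideal. *)
Definition is_maximal_ideal (M : set R) : Prop :=
  idealr_closed [in M] /\
  forall J : set R, idealr_closed [in J] -> M `<=` J -> J = M.

End MinimalExtensions.

(* The idealization R(+)E.  A record rather than an alias of R * E: when E is
   a ring, the product type already carries the componentwise multiplication. *)
Record idealization (R : comNzRingType) (E : lmodType R) :=
  Idealization { idz_ring : R; idz_mod : E }.

Section Idealization.
Variables (R : comNzRingType) (E : lmodType R).

Let idz_pair (x : idealization E) : R * E := (idz_ring x, idz_mod x).
Let pair_idz (p : R * E) : idealization E := Idealization p.1 p.2.

Lemma idz_pairK : cancel idz_pair pair_idz. Proof. by case. Qed.

HB.instance Definition _ := Choice.copy (idealization E) (can_type idz_pairK).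

Definition idz_zero : idealization E := Idealization 0 0.
Definition idz_opp (x : idealization E) : idealization E :=
  Idealization (- idz_ring x) (- idz_mod x).
Definition idz_add (x y : idealization E) : idealization E :=
  Idealization (idz_ring x + idz_ring y) (idz_mod x + idz_mod y).
Definition idz_one : idealization E := Idealization 1 0.
Definition idz_mul (x y : idealization E) : idealization E :=
  Idealization (idz_ring x * idz_ring y)
               (idz_ring x *: idz_mod y + idz_ring y *: idz_mod x).

Lemma idz_addA : associative idz_add.
Proof. by move=> x y z; rewrite /idz_add /= !addrA. Qed.

Lemma idz_addC : commutative idz_add.
Proof. by move=> x y; congr Idealization; apply: addrC. Qed.

Lemma idz_add0 : left_id idz_zero idz_add.
Proof. by case=> r e; congr Idealization; apply: add0r. Qed.

Lemma idz_addN : left_inverse idz_zero idz_opp idz_add.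
Proof. by move=> x; congr Idealization; apply: addNr. Qed.

HB.instance Definition _ := GRing.isZmodule.Build (idealization E)
  idz_addA idz_addC idz_add0 idz_addN.

Lemma idz_mulA : associative idz_mul.
Proof.
move=> [r1 e1] [r2 e2] [r3 e3]; congr Idealization => /=; first exact: mulrA.
by rewrite !scalerDr !scalerA addrA (mulrC r3 r1) (mulrC r3 r2).
Qed.

Lemma idz_mulC : commutative idz_mul.
Proof. by move=> x y; congr Idealization; [apply: mulrC | apply: addrC]. Qed.

Lemma idz_mul1 : left_id idz_one idz_mul.
Proof.
by case=> r e; rewrite /idz_mul /= mul1r scale1r scaler0 addr0.
Qed.

Lemma idz_mulDl : left_distributive idz_mul idz_add.
Proof.
move=> [r1 e1] [r2 e2] [r3 e3]; congr Idealization => /=; first exact: mulrDl.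
by rewrite scalerDl scalerDr addrACA.
Qed.

Lemma idz_one_neq0 : idz_one != 0.
Proof. by apply/eqP => -[] /eqP; rewrite oner_eq0. Qed.

HB.instance Definition _ := GRing.Zmodule_isComNzRing.Build (idealization E)
  idz_mulA idz_mulC idz_mul1 idz_mulDl idz_one_neq0.

Definition idz_embed (r : R) : idealization E := Idealization r 0.

Lemma idz_embed_is_zmod_morphism : zmod_morphism idz_embed.
Proof. by move=> r s; congr Idealization; rewrite /= subr0. Qed.

Lemma idz_embed_is_monoid_morphism : monoid_morphism idz_embed.
Proof.
by split=> // r s; congr Idealization; rewrite /= !scaler0 addr0.
Qed.

HB.instance Definition _ :=
  GRing.isZmodMorphism.Build R (idealization E) idz_embed idz_embed_is_zmod_morphism.
HB.instance Definition _ :=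
  GRing.isMonoidMorphism.Build R (idealization E) idz_embed
    idz_embed_is_monoid_morphism.

Lemma idz_embed_inj : injective idz_embed.
Proof. by move=> r s []. Qed.

End Idealization.

Arguments idz_embed {R} E r.

(* Main.v *)
Require Import Defs.
From mathcomp Require Import all_boot all_algebra.
From mathcomp Require Import boolp classical_sets.

(** A subring of R(+)E that contains R is determined by its elements (0, e):
    subtracting (r, 0) from (r, e) stays inside the subring.  These elements
    form a submodule N of E, and conversely R(+)N is a subring for every
    submodule N, because (0, E) squares to zero and hence closure under
    products only asks for closure under scaling.  So the rings between R and
    R(+)E are ordered like the submodules of E ([overring_idz_over],
    [idz_overS]), and R(+)N is a maximal subring exactly when N is a maximal
    submodule ([minimal_idz_over]).

    Since (a, 0) lies in R, the ring R[(a, e)] is R[(0, e)], that is R(+)N for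
    N the cyclic submodule generated by e ([adjoin_idz]).  When E = R,
    submodules are ideals, the maximal ones are the maximal ideals
    ([maximal_submodule_ideal]), and the cyclic submodule generated by b is
    the principal ideal of b. *)

Set Implicit Arguments.
Unset Strict Implicit.
Unset Printing Implicit Defensive.

Import GRing.Theory.
Local Open Scope classical_set_scope.
Local Open Scope ring_scope.

Section OverringsAndSubmodules.
Variables (R : comNzRingType) (E : lmodType R).
Implicit Types (N K : set E) (B : set (idealization E)).

Definition idz_over N : set (idealization E) := [set x | N (idz_mod x)].

Definition idz_fiber B : set E := [set e | B (Idealization 0 e)].

Definition maximal_submodule N : Prop :=
  [/\ submod_closed [in N], N `<` setT &
      forall K, submod_closed [in K] -> N `<=` K -> K <> setT -> K = N].

Lemma submod_setP N : submod_closed [in N] <->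
  N 0 /\ forall r u v, N u -> N v -> N (r *: u + v).
Proof.
split=> -[N0 NL]; split; first by move: N0; rewrite inE.
- by move=> r u v Nu Nv; move: (NL r u v); rewrite !inE; apply.
- by rewrite inE.
- by move=> r u v; rewrite !inE; apply: (NL).
Qed.

Lemma subring_setP (S : comNzRingType) (A : set S) : is_subring A <->
  [/\ A 1, forall x y, A x -> A y -> A (x - y) &
           forall x y, A x -> A y -> A (x * y)].
Proof.
split=> -[A1 AB AM]; split.
- by move: A1; rewrite inE.
- by move=> x y Ax Ay; move: (AB x y); rewrite !inE; apply.
- by move=> x y Ax Ay; move: (AM x y); rewrite !inE; apply.
- by rewrite inE.
- by move=> x y; rewrite !inE; apply: AB.
- by move=> x y; rewrite !inE; apply: AM.
Qed.

Lemma submod_cyclic (e : E) : submod_closed [in range (fun r : R => r *: e)].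
Proof.
apply/submod_setP; split; first by exists 0; rewrite ?scale0r.
by move=> r _ _ [s _ <-] [t _ <-]; exists (r * s + t); rewrite // scalerDl scalerA.
Qed.

(** Together with [overring_idz_over], this makes N |-> R(+)N an isomorphism of
    ordered sets, which carries maximality statements across. *)
Lemma idz_overS N K : (idz_over N `<=` idz_over K) = (N `<=` K).
Proof.
apply/propext; split=> [sNK e Ne | sNK x]; last exact: sNK.
exact: (sNK (Idealization 0 e)).
Qed.

Lemma idz_overT : idz_over setT = setT.
Proof. by apply/seteqP; split. Qed.

Lemma idz_over_proper N K : (idz_over N `<` idz_over K) = (N `<` K).
Proof. by rewrite /proper !idz_overS. Qed.

Lemma subring_idz_over N : submod_closed [in N] -> is_subring (idz_over N).
Proof.
move=> /submod_setP[N0 NL]; apply/subring_setP; split=> //.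
- by move=> x y Nx Ny; rewrite /idz_over /= addrC -scaleN1r; apply: (NL).
- move=> x y Nx Ny; apply: (NL) => //.
  by rewrite -[_ *: _]addr0; apply: (NL).
Qed.

Lemma range_embed_idz_over N :
  submod_closed [in N] -> range (idz_embed E) `<=` idz_over N.
Proof. by move=> /submod_setP[N0 _] _ [r _ <-]. Qed.

(** The scaling in the fiber comes from (r, 0)(0, e) = (0, re), and the
    fiber determines B because (r, e) = (r, 0) + (0, e). *)
Lemma overring_idz_over B : is_subring B -> range (idz_embed E) `<=` B ->
  submod_closed [in idz_fiber B] /\ B = idz_over (idz_fiber B).
Proof.
move=> /subring_setP[B1 BB BM] sRB.
have BR r : B (idz_embed E r) by apply: sRB; exists r.
have BD x y : B x -> B y -> B (x + y).
  move=> Bx By; rewrite -[y]opprK; apply: (BB) => //.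
  by rewrite -sub0r; apply: (BB) => //; exact: (BR 0).
split.
  apply/submod_setP; split=> [|r u v Bu Bv]; first exact: (BR 0).
  have -> : idz_fiber B (r *: u + v) =
      B (idz_embed E r * Idealization 0 u + Idealization 0 v).
    by congr B; congr Idealization; rewrite /= ?scaler0 ?mulr0 !addr0.
  by apply: (BD) => //; apply: (BM).
apply/seteqP; split=> -[r e] Be.
- have -> : idz_over (idz_fiber B) (Idealization r e) =
      B (Idealization r e - idz_embed E r).
    by congr B; congr Idealization; rewrite /= ?subrr ?subr0.
  exact: BB.
- have -> : Idealization r e = idz_embed E r + Idealization 0 e.
    by congr Idealization; rewrite /= ?addr0 ?add0r.
  exact: BD.
Qed.

(** An overring contains (a, e) exactly when it contains (0, e), so the
    least one is the one over the least submodule containing e. *)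
Lemma adjoin_idz (a : R) (e : E) :
  adjoin (idz_embed E) (Idealization a e) =
  idz_over (range (fun r : R => r *: e)).
Proof.
have cyc := submod_cyclic e.
apply/seteqP; split.
  apply: smallest_sub; first exact: subring_idz_over.
  move=> x [xR | ->]; first exact: range_embed_idz_over xR.
  by exists 1; rewrite ?scale1r.
move=> x + B [subB sB]; move: x.
have sRB : range (idz_embed E) `<=` B by move=> x ?; apply: sB; left.
have [/submod_setP[F0 FL] eqB] := overring_idz_over subB sRB.
rewrite eqB -/(_ `<=` _) idz_overS => _ [r _ <-].
rewrite -[_ *: _]addr0; apply: FL => //.
have : B (Idealization a e) by apply: sB; right.
by rewrite eqB.
Qed.

(** Both sides speak of the absence of something strictly in between, and
    every ring above R(+)N is itself of the form R(+)K. *)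
Lemma minimal_idz_over N : submod_closed [in N] ->
  minimal_ring_extension (idz_over N) <-> maximal_submodule N.
Proof.
move=> subN; split=> [[_ pN noB] | [_ pN maxN]]; split=> //.
- by rewrite -idz_over_proper idz_overT.
- move=> K subK sNK KnT; apply: contrapT => KnN; apply: noB.
  exists (idz_over K); split; first exact: subring_idz_over.
    by rewrite idz_over_proper properEneq; split=> //; apply/eqP => /esym.
  by rewrite -idz_overT idz_over_proper properEneq; split=> //; apply/eqP.
- exact: subring_idz_over.
- by rewrite -idz_overT idz_over_proper.
move=> [B [subB [sNB nBN] pB]]; apply: nBN.
have sRB := subset_trans (range_embed_idz_over subN) sNB.
have [fibB eqB] := overring_idz_over subB sRB.
move: sNB pB; rewrite eqB -idz_overT idz_overS idz_over_proper.
by rewrite properEneq => sNF [/eqP FnT _]; rewrite (maxN _ fibB).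
Qed.

End OverringsAndSubmodules.

Section Ideals.
Variable R : comNzRingType.
Implicit Types I : set R^o.

(** An ideal in the sense of [idealr_closed] is a submodule of R^o to which 1 does
    not belong; this turns the latter condition into properness. *)
Lemma submod_proper1 I : submod_closed [in I] -> I 1 <-> I = setT.
Proof.
move=> /submod_setP[I0 IL]; split=> [I1 | ->] //.
apply/seteqP; split=> // r _.
by rewrite -[r]mulr1 -[_ * _]addr0; apply: (IL).
Qed.

Lemma idealr_closedP I :
  idealr_closed [in (I : set R)] <-> submod_closed [in I] /\ I <> setT.
Proof.
split=> [[I0 I1 IL] | [subI InT]].
  have subI : submod_closed [in I] by [].
  split=> // /(submod_proper1 subI) I1'.
  by move/negP: I1; apply; rewrite inE.
have [I0 IL] := subI; split=> //.
by apply/negP; rewrite inE => /(submod_proper1 subI).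
Qed.

Lemma maximal_submodule_ideal I :
  maximal_submodule I <-> is_maximal_ideal (I : set R).
Proof.
split=> [[subI pI maxI] | [/idealr_closedP[subI InT] maxI]]; split=> //.
- apply/idealr_closedP; split=> //.
  by move: pI; rewrite properEneq => -[/eqP].
- by move=> J /idealr_closedP[subJ JnT] sIJ; apply: maxI.
- by rewrite properEneq; split=> //; apply/eqP.
- by move=> K subK sIK KnT; apply: maxI => //; apply/idealr_closedP.
Qed.

End Ideals.

Theorem proposition2p5 (R : comNzRingType) (a b : R) :
  minimal_ring_extension
    (adjoin (idz_embed R^o) (Idealization (E := R^o) a b)) <->
  is_maximal_ideal (principal_ideal b).
Proof.
rewrite adjoin_idz.
apply: iff_trans (maximal_submodule_ideal _).
exact: minimal_idz_over (submod_cyclic (b : R^o)).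
Qed.
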